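(* Let $\mathbb F$ be a field, $n\ge 2$, $\delta\in\{1,\dots,n\}$, and let $\mathcal C\subseteq\mathrm{U}(n,\mathbb F)$ be an $\mathbb F$-linear subspace of dimension $f(n,\delta)$ whose minimum flag-rank distance is $r$. The following are equivalent: (1) $r=\delta$, i.e. $\mathcal C$ is an $\{n,f(n,\delta),\delta\}_{\mathbb F}$ MFRD code; (2) every nonzero element of $\mathcal C\cap\mathrm{D}(\delta-1,n,\mathbb F)$ has flag-rank weight at least $\delta$, and $\mathcal C\cap\mathrm{D}(\delta-1,n,\mathbb F)$ has codimension $g(\delta)$ in $\mathrm{D}(\delta-1,n,\mathbb F)$; equivalently, its dimension is $y=f(n,\delta)-\frac{(n-\delta+1)(n-\delta+2)}{2}$; (3) $\big(\mathcal C\cap\mathrm{D}(\delta-1,n,\mathbb F)\big)\oplus\phi_{1,\delta}(\mathrm{U}(n-\delta+1,\mathbb F))$ is an $\{n,f(n,\delta),\delta\}_{\mathbb F}$ MFRD code.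
   Context: $\mathrm{U}(m,\mathbb F)$ is the space of $m\times m$ upper triangular matrices over $\mathbb F$. For $M\in\mathrm{U}(n,\mathbb F)$, $M_{[i]}$ is the submatrix with rows $1,\dots,i$ and columns $i,\dots,n$; the flag-rank weight is $\mathrm{w}_{\mathrm{fr}}(M)=\sum_{i=1}^n\operatorname{rk}(M_{[i]})$; the minimum flag-rank distance of a subspace is the minimum weight of its nonzero elements. An $\{n,t,\delta\}_{\mathbb F}$ code is a $t$-dimensional subspace of $\mathrm{U}(n,\mathbb F)$ with minimum flag-rank distance $\delta$. $g(\delta)=\delta-1+\lfloor\sqrt{\delta-1}\rfloor\cdot\lfloor(\sqrt{4(\delta-1)+1}-1)/2\rfloor$, $f(n,\delta)=n(n+1)/2-g(\delta)$; MFRD means an $\{n,f(n,\delta),\delta\}_{\mathbb F}$ code. $\mathrm{D}(r,n,\mathbb F)=\{(m_{ij})\in\mathrm{U}(n,\mathbb F): m_{ij}=0 \text{ if } j-i\ge r\}$. For $\ell=n-\delta+1$, $\phi_{1,\delta}:\mathrm{Mat}(\ell,\mathbb F)\to\mathrm{Mat}(n,\mathbb F)$ places an $\ell\times\ell$ matrix in rows $1,\dots,\ell$ and columns $\delta,\dots,n$ and puts $0$ elsewhere. *)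

(* Defs.v *)
From HB Require Import structures.
From mathcomp Require Import all_boot all_order all_algebra.
From mathcomp Require Import realalg ring lra zify.

Set Implicit Arguments.
Unset Strict Implicit.
Unset Printing Implicit Defensive.

Import Order.TTheory GRing.Theory Num.Theory.
Local Open Scope ring_scope.

(* Rows and columns are numbered from 0 here, from 1 in the usual notation:
   index i : 'I_n stands for row (or column) i + 1. *)

Section Supports.
Variables (F : fieldType) (n : nat) (P : rel nat).

Definition off_part (M : 'M[F]_n) : 'M[F]_n :=
  \matrix_(i, j) (if P i j then 0 else M i j).

Fact off_part_is_linear : linear off_part.
Proof.
move=> a A B; apply/matrixP=> i j; rewrite !mxE.
by case: ifP; rewrite ?mulr0 ?addr0.
Qed.

HB.instance Definition _ :=
  GRing.isLinear.Build F 'M[F]_n 'M[F]_n _ off_part off_part_is_linear.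

(* The space of the matrices whose (i, j) entry is 0 unless P i j. *)
Definition supp_space : {vspace 'M[F]_n} := lker (linfun off_part).

Lemma mem_supp_space (M : 'M[F]_n) :
  reflect (forall i j : 'I_n, ~~ P i j -> M i j = 0) (M \in supp_space).
Proof.
rewrite memv_ker lfunE; apply: (iffP eqP) => [/matrixP M0 i j /negPf nP | M0].
  by have := M0 i j; rewrite !mxE nP.
by apply/matrixP=> i j; rewrite !mxE; case: ifPn => // /M0.
Qed.

End Supports.

(* U(n, F) *)
Definition Uspace (F : fieldType) (n : nat) : {vspace 'M[F]_n} :=
  supp_space F n (fun i j => i <= j)%N.

(* D(r, n, F): the upper triangular matrices with m_ij = 0 if j - i >= r;
   the difference is not written with the truncated subtraction of nat. *)
Definition Dspace (F : fieldType) (r n : nat) : {vspace 'M[F]_n} :=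
  supp_space F n (fun i j => i <= j < i + r)%N.

(* M_[k+1]: rows 0, ..., k and columns k, ..., n - 1. *)
Definition flag_sub (F : fieldType) (n : nat) (M : 'M[F]_n) (k : 'I_n) :
    'M[F]_(k.+1, n - k) :=
  mxsub (widen_ord (ltn_ord k))
        (fun j => cast_ord (subnKC (ltnW (ltn_ord k))) (rshift k j)) M.

Definition frweight (F : fieldType) (n : nat) (M : 'M[F]_n) : nat :=
  (\sum_(k < n) \rank (flag_sub M k))%N.

(* No d satisfies this when C = 0. *)
Definition is_min_frdist (F : fieldType) (n : nat)
    (C : {vspace 'M[F]_n}) (d : nat) : Prop :=
  (exists M, [/\ M \in C, M != 0 & frweight M = d]) /\
  (forall M, M \in C -> M != 0 -> (d <= frweight M)%N).

Definition is_code (F : fieldType) (n t d : nat)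
    (C : {vspace 'M[F]_n}) : Prop :=
  [/\ (C <= Uspace F n)%VS, \dim C = t & is_min_frdist C d].

(* The real numbers under the floors are algebraic and nonnegative, so that
   Num.truncn is the floor. *)
Definition g (d : nat) : nat :=
  ((d - 1) +
   Num.truncn (Num.sqrt (d - 1)%:R : realalg) *
   Num.truncn ((Num.sqrt (4 * (d - 1) + 1)%:R - 1) / 2 : realalg))%N.

Definition f (n d : nat) : nat := ((n * (n + 1)) %/ 2 - g d)%N.

Definition is_MFRD (F : fieldType) (n d : nat)
    (C : {vspace 'M[F]_n}) : Prop :=
  is_code (f n d) d C.

(* phi_{1,d}: the entry (a, b) of A goes to position (a, b + d - 1)
   (numbering from 0), for 1 <= d <= n. *)
Definition phi1 (F : fieldType) (n d : nat) (A : 'M[F]_(n - d + 1)) :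
    'M[F]_n :=
  \matrix_(i, j) \sum_(a < n - d + 1)
    \sum_(b < n - d + 1 | (i == a :> nat) && (j == b + (d - 1) :> nat)%N)
      A a b.

Fact phi1_is_linear (F : fieldType) (n d : nat) : linear (@phi1 F n d).
Proof.
move=> c A B; apply/matrixP=> i j; rewrite !mxE mulr_sumr -big_split /=.
apply: eq_bigr => a _; rewrite mulr_sumr -big_split /=.
by apply: eq_bigr => b _; rewrite !mxE.
Qed.

HB.instance Definition _ (F : fieldType) (n d : nat) :=
  GRing.isLinear.Build F 'M[F]_(n - d + 1) 'M[F]_n _ (@phi1 F n d)
    (@phi1_is_linear F n d).

Definition phi1U (F : fieldType) (n d : nat) : {vspace 'M[F]_n} :=
  (linfun (@phi1 F n d) @: Uspace F (n - d + 1))%VS.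

Lemma mem_phi1U (F : fieldType) (n d : nat) (M : 'M[F]_n) :
  reflect (exists2 A, A \in Uspace F (n - d + 1) & M = phi1 A)
          (M \in phi1U F n d).
Proof.
apply: (iffP memv_imgP) => -[A UA ->]; exists A; rewrite ?lfunE //.
Qed.

(* The subtractions in f n d and in f n d - (n - d + 1)(n - d + 2) / 2 are
   never truncated. *)
Lemma g_bound (n d : nat) : (1 <= d <= n)%N ->
  (g d + ((n - d + 1) * (n - d + 2)) %/ 2 <= (n * (n + 1)) %/ 2)%N.
Proof.
case/andP=> d1 dn; rewrite /g.
set s := Num.truncn _; set t := Num.truncn _.
have hs : (s * s <= d - 1)%N.
  have : (s%:R <= Num.sqrt (d - 1)%:R :> realalg).
    by rewrite truncn_le sqrtr_ge0.
  move=> h; rewrite -(ler_nat realalg) natrM -[leRHS]sqr_sqrtr ?ler0n //.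
  by rewrite -expr2 lerXn2r ?nnegrE ?ler0n ?sqrtr_ge0.
have ht : (t * (t + 1) <= d - 1)%N.
  have : (t%:R <= (Num.sqrt (4 * (d - 1) + 1)%:R - 1) / 2 :> realalg).
    rewrite truncn_le divr_ge0 ?ler0n // subr_ge0.
    by rewrite -{1}sqrtr1 ler_sqrt ?ler0n // ler1n addn1.
  rewrite ler_pdivlMr ?ltr0n // lerBrDr => h.
  suff : ((2 * t + 1) * (2 * t + 1) <= 4 * (d - 1) + 1)%N by lia.
  rewrite -(ler_nat realalg) natrM -[leRHS]sqr_sqrtr ?ler0n //.
  have e : (2 * t + 1)%:R = t%:R * 2 + 1 :> realalg.
    by rewrite natrD natrM mulrC.
  by rewrite -expr2 lerXn2r ?nnegrE ?ler0n ?sqrtr_ge0 // e.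
have hst : (s * t <= d - 1)%N.
  by case: (leqP s t) => ?; nia.
have [k nE] : exists k, n = (k + d)%N by exists (n - d)%N; lia.
have [e dE] : exists e, d = e.+1 by exists d.-1; lia.
have hst1 : (e = 1 -> s * t = 0)%N by move=> e1; nia.
move: (s * t)%N hst hst1 => p {s t hs ht} hp h1; subst n d; move: hp h1 {d1 dn}.
rewrite (_ : (k + e.+1 - e.+1) = k)%N; last by lia.
rewrite (_ : (e.+1 - 1) = e)%N; last by lia.
move=> hp h1.
have : (2 * (e + p) + (k + 1) * (k + 2) <= (k + e.+1) * (k + e.+1 + 1))%N.
  case: e hp h1 => [|[|e]] hp h1; nia.
have o2 m : (2 %| m * (m + 1))%N.
  by rewrite dvdn2 oddM oddD /=; case: (odd m).
have := o2 (k + 1)%N; have := o2 (k + e.+1)%N.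
by rewrite -(addnA k 1 1) => /dvdnP[x ->] /dvdnP[y ->]; rewrite !mulnK //; lia.
Qed.

(* Main.v *)
(* A nonzero entry at (i, j) contributes to j - i + 1 flag submatrices, so every
   upper triangular matrix outside D(d - 1) has weight at least d, and C has
   minimum distance at least d iff its part in D(d - 1) has.
   Conversely, the matrices supported on a leading triangle of size m and on e
   further diagonal positions all have small weight.  Choosing m from the two
   square roots in g, there is such a space of dimension g d inside D(d - 1) with
   all weights at most d - 1, and one of dimension g d + 1 with all weights at most d.
   Trivial intersection with the first gives the codimension of C in D(d - 1),
   with the second that the minimum distance cannot exceed d. *)

Require Import Defs.
From mathcomp Require Import all_boot all_order all_algebra.
From mathcomp Require Import realalg zify.

Set Implicit Arguments.
Unset Strict Implicit.
Unset Printing Implicit Defensive.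

Import Order.TTheory GRing.Theory Num.Theory.
Local Open Scope ring_scope.

(** * The two floors in [g] *)

Lemma sqr_truncn_sqrt (k : nat) (s := Num.truncn (Num.sqrt k%:R : realalg)) :
  (s * s <= k < s.+1 * s.+1)%N.
Proof.
have /andP[lo hi] := truncn_itv (sqrtr_ge0 (k%:R : realalg)).
rewrite -(ltr_nat realalg) -(ler_nat realalg) !natrM -!expr2.
rewrite -[k%:R in X in X && _]sqr_sqrtr ?ler0n // -[k%:R in X in _ && X]sqr_sqrtr ?ler0n //.
by rewrite lerXn2r ?ltrXn2r ?nnegrE ?sqrtr_ge0.
Qed.

(** The nonnegative root of x(x + 1) = k is (sqrt(4k + 1) - 1) / 2, so its floor is the largest [t]
    with t(t + 1) <= k. *)
Lemma pronic_truncn_sqrt (k : nat)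
    (t := Num.truncn ((Num.sqrt (4 * k + 1)%:R - 1) / 2 : realalg)) :
  (t * t.+1 <= k < t.+1 * t.+2)%N.
Proof.
have x_ge0 : 0 <= (Num.sqrt (4 * k + 1)%:R - 1) / 2 :> realalg.
  by rewrite divr_ge0 ?ler0n // subr_ge0 -{1}sqrtr1 ler_sqrt ?ler0n // ler1n addn1.
have := truncn_itv x_ge0; rewrite -/t.
rewrite ler_pdivlMr ?ltr0n // lerBrDr ltr_pdivrMr ?ltr0n // ltrBlDr.
rewrite -!natrM -!(natrD _ _ 1) => /andP[lo hi].
have lo2 : ((t * 2 + 1) * (t * 2 + 1) <= 4 * k + 1)%N.
  rewrite -(ler_nat realalg) natrM -expr2 -[leRHS]sqr_sqrtr ?ler0n //.
  by rewrite lerXn2r ?nnegrE ?sqrtr_ge0.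
have hi2 : (4 * k + 1 < (t.+1 * 2 + 1) * (t.+1 * 2 + 1))%N.
  rewrite -(ltr_nat realalg) natrM -expr2 -[ltLHS]sqr_sqrtr ?ler0n //.
  by rewrite ltrXn2r ?sqrtr_ge0.
by apply/andP; split; nia.
Qed.

(** Here [s] and [t] are the two floors in [g]. They interlace, so s(t + 1) is t(t + 1) or (t +
    1)^2, at most d - 1 in both cases, and [e] is the excess. A triangle of size s + t with [e]
    further diagonal positions then has [g d] cells. *)
Lemma g_shape (d : nat) : exists s t e : nat,
  [/\ (t <= s <= t + 1)%N, (d - 1 = s * (t + 1) + e)%N & g d = (d - 1 + s * t)%N].
Proof.
rewrite /g; move: (sqr_truncn_sqrt (d - 1)) (pronic_truncn_sqrt (d - 1)).
move: (Num.truncn _) (Num.truncn _) => t s /andP[s_le s_gt] /andP[t_le t_gt].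
(* Otherwise (s + 1)^2 <= t^2 <= d - 1 or (t + 1)(t + 2) <= s^2 <= d - 1, against the upper bounds
   on d - 1. *)
have ts : (t <= s <= t + 1)%N.
  apply/andP; split; rewrite leqNgt; apply/negP => lt; last first.
    have lt' : (t.+1 <= s)%N by lia.
    have := leq_mul lt' (_ : t.+2 <= s)%N; lia.
  have := leq_mul lt lt; nia.
exists s, t, (d - 1 - s * (t + 1))%N; split => //.
have [sE|sE] : s = t \/ s = (t + 1)%N by lia.
  by subst s; nia.
by subst s; nia.
Qed.

(** * Dimensions of spaces with prescribed support *)

Section SupportCount.
Variables (F : fieldType) (n : nat).
Implicit Types (P Q : rel nat).

Definition supp_card P : nat := (\sum_(j < n) \sum_(i < n) P i j)%N.

Lemma dim_supp_space_le P : (\dim (supp_space F n P) <= supp_card P)%N.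
Proof.
pose D := [pred p : 'I_n * 'I_n | P p.1 p.2].
pose s : seq 'M[F]_n := [seq delta_mx p.1 p.2 | p in D].
have -> : supp_card P = size s.
  rewrite size_image -sum1_card /supp_card exchange_big pair_big /=.
  by rewrite [RHS]big_mkcond; apply: eq_bigr => p _; rewrite inE; case: (P _ _).
apply: leq_trans (dim_span s); apply: dimvS; apply/subvP => M /mem_supp_space M0.
rewrite (matrix_sum_delta M); apply: rpred_sum => i _; apply: rpred_sum => j _.
case: (boolP (P i j)) => [Pij | /M0 ->]; last by rewrite scale0r mem0v.
apply/rpredZ/memv_span; exact: (image_f (fun p => delta_mx p.1 p.2) (x := (i, j))).
Qed.

Lemma supp_cardU P Q R : (forall i j, R i j = P i j || Q i j) ->
    (forall i j, ~~ (P i j && Q i j)) ->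
  supp_card R = (supp_card P + supp_card Q)%N.
Proof.
move=> Rpq PQ0; rewrite /supp_card -big_split; apply: eq_bigr => j _.
rewrite -big_split; apply: eq_bigr => i _.
by rewrite Rpq; have := PQ0 i j; case: (P i j); case: (Q i j).
Qed.

(* The bound above holds for P and for its complement, and both bounds add up to
   the dimension of the whole space. *)
Lemma dim_supp_space P : \dim (supp_space F n P) = supp_card P.
Proof.
pose Q : rel nat := fun i j => ~~ P i j.
have full : (fullv <= supp_space F n P + supp_space F n Q)%VS.
  apply/subvP => M _; rewrite -[M](subrK (off_part P M)).
  apply: memv_add; apply/mem_supp_space => i j nP; rewrite !mxE.
    by rewrite (negbTE nP) subrr.
  by move: nP; rewrite negbK => ->.
have cardT : supp_card (fun _ _ => true) = (n * n)%N.
  rewrite /supp_card pair_big /= (eq_bigr (fun=> 1%N)) //.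
  by rewrite sum1_card card_prod card_ord.
have cardPQ : supp_card (fun _ _ => true) = (supp_card P + supp_card Q)%N.
  by apply: supp_cardU => i j; rewrite /Q; case: (P i j).
have := leq_trans (dimvS full) (leq_of_leqif (dimv_add_leqif _ _)).
rewrite dimvf dim_matrix; move: (dim_supp_space_le P) (dim_supp_space_le Q).
by lia.
Qed.

Lemma supp_spaceS P Q : (forall i j, P i j -> Q i j) ->
  (supp_space F n P <= supp_space F n Q)%VS.
Proof.
move=> PQ; apply/subvP => M /mem_supp_space M0; apply/mem_supp_space => i j nQ.
by apply: M0; apply: contra nQ; apply: PQ.
Qed.

End SupportCount.

Lemma sum_ltn (n c : nat) : (c <= n)%N -> (\sum_(i < n) (i < c) = c)%N.
Proof.
move=> cn; rewrite -[RHS]card_ord -sum1_card (big_ord_widen n (fun=> 1%N) cn) [RHS]big_mkcond.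
by apply: eq_bigr => i _; case: ltnP.
Qed.

Lemma dim_supp_space_offset (F : fieldType) (n c : nat) :
  (2 * \dim (supp_space F n (fun i j => i + c <= j)) = (n - c) * (n - c + 1))%N.
Proof.
rewrite dim_supp_space /supp_card.
(* Truncation makes the count 0 for the columns j < c, so [c] may exceed [n]. *)
have -> : (\sum_(j < n) \sum_(i < n) (i + c <= j) = \sum_(j < n) (j.+1 - c))%N.
  apply: eq_bigr => j _; rewrite -(@sum_ltn n (j.+1 - c)); last by have := ltn_ord j; lia.
  by apply: eq_bigr => i _; congr nat_of_bool; lia.
elim: n => [|n IHn]; first by rewrite big_ord0.
by rewrite big_ord_recr /= mulnDr IHn; nia.
Qed.

Lemma dim_Uspace (F : fieldType) (n : nat) : (2 * \dim (Uspace F n) = n * (n + 1))%N.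
Proof.
rewrite -[in RHS](subn0 n) -(dim_supp_space_offset F n 0) !dim_supp_space.
by congr (2 * _)%N; apply: eq_bigr => j _; apply: eq_bigr => i _; rewrite addn0.
Qed.

Lemma dim_Uspace_Dspace (F : fieldType) (n r : nat) :
  \dim (Uspace F n) =
    (\dim (Dspace F r n) + \dim (supp_space F n (fun i j => i + r <= j)))%N.
Proof. by rewrite !dim_supp_space; apply: supp_cardU => i j; lia. Qed.

(** * The image of [phi1] *)

Lemma phi1_entry (F : fieldType) (n d : nat) (A : 'M[F]_(n - d + 1)) (i j : 'I_n)
    (a b : 'I_(n - d + 1)) :
  i = a :> nat -> j = (b + (d - 1))%N :> nat -> phi1 A i j = A a b.
Proof.
move=> ia jb; rewrite mxE (bigD1 a) //= [X in _ + X]big1 ?addr0; last first.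
  move=> a' /negP na; apply: big1 => b' /andP[/eqP ia' _]; case: na.
  by apply/eqP/val_inj; rewrite /= -ia'.
rewrite (bigD1 b) /= ?ia ?jb ?eqxx //= big1 ?addr0 // => b' /andP[/eqP bb' /negP[]].
by apply/eqP/val_inj => /=; lia.
Qed.

Lemma phi1U_sub (F : fieldType) (n d : nat) :
  (phi1U F n d <= supp_space F n (fun i j => i + (d - 1) <= j)%N)%VS.
Proof.
apply/subvP => _ /mem_phi1U[A /mem_supp_space UA ->]; apply/mem_supp_space => i j nij.
rewrite mxE; apply: big1 => a _; apply: big1 => b /andP[/eqP ia /eqP jb].
by apply: UA; lia.
Qed.

Lemma dim_phi1U (F : fieldType) (n d : nat) : (1 <= d <= n)%N ->
  \dim (phi1U F n d) = \dim (Uspace F (n - d + 1)).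
Proof.
move=> hd; apply: limg_dim_eq; apply/eqP; rewrite -subv0; apply/subvP => A.
rewrite memv_cap memv_ker lfunE memv0 => /andP[_ /eqP A0].
apply/eqP/matrixP => a b; rewrite mxE.
(* The bounds on [d] keep every target position inside the n by n matrix, so each entry of [A] can
   be read off [phi1 A]. *)
have ha : (a < n)%N by have := ltn_ord a; lia.
have hb : (b + (d - 1) < n)%N by have := ltn_ord b; lia.
by rewrite -(@phi1_entry _ _ _ A (Ordinal ha) (Ordinal hb)) //= A0 mxE.
Qed.

Lemma Dspace_phi1U_disjoint (F : fieldType) (n d : nat) :
  (Dspace F (d - 1) n :&: phi1U F n d)%VS = 0%VS.
Proof.
apply/eqP; rewrite -subv0; apply/subvP => M /memv_capP[/mem_supp_space MD].
move=> /(subvP (@phi1U_sub F n d))/mem_supp_space MK; rewrite memv0; apply/eqP/matrixP => i j.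
rewrite mxE; have [ij|ij] := boolP (i + (d - 1) <= j)%N; last exact: MK.
by apply: MD; lia.
Qed.

(** * Bounds on the flag-rank weight *)

Lemma frweight_entry (F : fieldType) (n : nat) (M : 'M[F]_n) (i j : 'I_n) :
  (i <= j)%N -> M i j != 0 -> (j - i < frweight M)%N.
Proof.
move=> ij Mij; apply: (@leq_trans (\sum_(k < n) (i <= k <= j))%N); last first.
  apply: leq_sum => k _; case: (boolP (i <= k <= j)%N) => // /andP[ik kj].
  rewrite lt0n mxrank_eq0; apply: contra Mij => /eqP/matrixP M0.
  (* Column [j] of [M] is column [j - k] of the [k]-th flag submatrix. *)
  have jk : (j - k < n - k)%N by have := ltn_ord j; lia.
  have := M0 (Ordinal (ik : (i < k.+1)%N)) (Ordinal jk); rewrite !mxE => <-.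
  by apply/eqP; congr (M _ _); apply: val_inj => /=; lia.
rewrite -(subSn ij) -(big_mkord xpredT (fun k => nat_of_bool (i <= k <= j)%N)).
have jn := ltn_ord j.
rewrite (big_cat_nat (n := i)) //=; last by lia.
rewrite (big_cat_nat (n := j.+1) (m := i)) //=; last by lia.
rewrite (eq_big_nat _ _ (F2 := fun=> 1%N) (m := i)); last by move=> k; case: (i <= k)%N => //=; lia.
by rewrite sum_nat_const_nat; lia.
Qed.

(** Beyond the easy case q <= c, right multiplication by [pid_mx c] leaves [A] unchanged, so [A] has
    rank at most that of [pid_mx c]. *)
Lemma rank_left_cols (F : fieldType) (p q c : nat) (A : 'M[F]_(p, q)) :
  (forall i (j : 'I_q), (c <= j)%N -> A i j = 0) -> (\rank A <= c)%N.
Proof.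
have [qc _|cq A0] := leqP q c; first exact: leq_trans (rank_leq_col A) qc.
have -> : A = A *m (pid_mx c : 'M_q).
  apply/matrixP => i j; rewrite !mxE (bigD1 j) //= !mxE eqxx /=.
  rewrite big1 => [|k /negbTE kj]; last by rewrite !mxE (_ : (k == j :> nat) = false) ?mulr0.
  by case: ltnP => [_|/A0 ->]; rewrite ?mulr1 ?mul0r addr0.
by rewrite (leq_trans (mxrankM_maxr _ _)) // rank_pid_mx // ltnW.
Qed.

Definition stair (m e : nat) : rel nat :=
  fun i j => (i <= j < m)%N || ((i == j) && (m <= j < m + e)%N).

Lemma dim_stair (F : fieldType) (n m e : nat) : (m + e <= n)%N ->
  (2 * \dim (supp_space F n (stair m e)) = m * (m + 1) + 2 * e)%N.
Proof.
move=> men; rewrite dim_supp_space /supp_card.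
(* The number of cells of [stair m e] in column [j]. *)
pose h j := if (j < m)%N then j.+1 else nat_of_bool (j < m + e)%N.
have -> : (\sum_(j < n) \sum_(i < n) stair m e i j = \sum_(j < n) h j)%N.
  apply: eq_bigr => j _; rewrite /h; case: ltnP => jm.
    by rewrite -(sum_ltn (ltn_ord j)); apply: eq_bigr => i _; rewrite /stair; lia.
  rewrite (bigD1 j) //= big1 => [|i]; first by rewrite /stair eqxx; lia.
  by rewrite -val_eqE /stair /=; lia.
have sum_h k : (2 * \sum_(j < k) h j =
    if k <= m then k * (k + 1) else m * (m + 1) + 2 * minn (k - m) e)%N.
  elim: k => [|k IHk]; first by rewrite big_ord0.
  rewrite big_ord_recr /= mulnDr IHk /h.
  case: (leqP k m) => km; case: (ltnP k m) => km'; [by nia | | by lia | by lia].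
  by have -> : k = m; lia.
by rewrite sum_h; case: leqP; nia.
Qed.

(* Upper bound for the rank of the k-th flag submatrix of a matrix supported on
   stair (s + t) e: its number of rows for k < t, of nonzero columns beyond. *)
Definition stair_rank (s t e k : nat) : nat :=
  if (k < t)%N then k.+1 else
  if (k < t + s)%N then (t + s - k)%N else nat_of_bool (k < t + s + e)%N.

(** The bounds run 1, ..., t, then s, ..., 1, then [e] ones, then zeros; [sum1], [sum2] and [sum3]
    add up these stretches in turn. *)
Lemma sum_stair_rank (s t e n : nat) : (t + s + e <= n)%N ->
  (2 * \sum_(k < n) stair_rank s t e k = t * (t + 1) + s * (s + 1) + 2 * e)%N.
Proof.
have sum1 x : (x <= t -> 2 * \sum_(k < x) stair_rank s t e k = x * (x + 1))%N.
  elim: x => [|x IHx] xt; first by rewrite big_ord0.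
  rewrite big_ord_recr /= mulnDr IHx ?(ltnW xt) // /stair_rank xt.
  by clear; lia.
(* [y] counts the terms of the descending stretch still to come, whose sum is y(y + 1) / 2. *)
have sum2 x y : (x + y = s -> 2 * \sum_(k < t + x) stair_rank s t e k + y * (y + 1)
    = t * (t + 1) + s * (s + 1))%N.
  elim: x y => [|x IHx] y xy; first by rewrite addn0 sum1 // -xy.
  have xy' : (x + y.+1 = s)%N by rewrite addnS.
  rewrite -(IHx y.+1) // addnS big_ord_recr /= mulnDr -addnA; congr (_ + _)%N.
  rewrite /stair_rank ltnNge leq_addr /= -xy' ltn_add2l addnS ltnS leq_addr.
  rewrite -addnS addnA addKn.
  by clear; lia.
have sum3 x : (2 * \sum_(k < t + s + x) stair_rank s t e k =
    t * (t + 1) + s * (s + 1) + 2 * minn x e)%N.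
  elim: x => [|x IHx]; first by rewrite min0n addn0 -(sum2 s 0%N) ?addn0.
  rewrite addnS big_ord_recr /= mulnDr IHx -addnA; congr (_ + _)%N.
  rewrite /stair_rank -[in X in (X < t)%N]addnA !ltnNge !leq_addr /= -ltnNge ltn_add2l.
  by clear; lia.
move=> le_n; rewrite -(subnKC (leq_trans (leq_addr e _) le_n)) sum3.
by rewrite (minn_idPr _) // leq_subRL // (leq_trans (leq_addr e _)).
Qed.

(** Cutting the triangle at index [t] balances rows against columns: for s = t and s = t + 1 alike,
    t(t + 1) / 2 + s(s + 1) / 2 = s(t + 1). *)
Lemma frweight_stair (F : fieldType) (n s t e : nat) (M : 'M[F]_n) :
    (s + t + e <= n)%N -> (t <= s <= t + 1)%N ->
  M \in supp_space F n (stair (s + t) e) -> (frweight M <= s * (t + 1) + e)%N.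
Proof.
move=> sten hts /mem_supp_space M0.
have : (frweight M <= \sum_(k < n) stair_rank s t e k)%N.
  apply: leq_sum => k _; rewrite /stair_rank; case: ltnP => kt; first exact: rank_leq_row.
  case: ltnP => kst; apply: rank_left_cols => i j hj; rewrite mxE; apply: M0 => /=;
    by rewrite /stair; have := ltn_ord i; lia.
rewrite -(leq_pmul2l (isT : 0 < 2)%N) sum_stair_rank; last by rewrite (addnC t).
move: (frweight M) => w hw; clear -hts hw.
by have [sE|sE] : s = t \/ s = (t + 1)%N; [lia | subst s; lia | subst s; lia].
Qed.

Lemma frweight_outside_Dspace (F : fieldType) (n d : nat) (M : 'M[F]_n) :
  M \in Uspace F n -> M \notin Dspace F (d - 1) n -> (d <= frweight M)%N.
Proof.
move=> /mem_supp_space U0 nD.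
have [i [j [nij Mij]]] : exists i j : 'I_n, ~~ (i <= j < i + (d - 1))%N /\ M i j != 0.
  case: (boolP [exists i : 'I_n, exists j : 'I_n,
                 ~~ (i <= j < i + (d - 1))%N && (M i j != 0)]).
    by move=> /existsP[i /existsP[j /andP[? ?]]]; exists i, j.
  rewrite negb_exists => /forallP H; case/negP: nD; apply/mem_supp_space => i j nij.
  have := H i; rewrite negb_exists => /forallP/(_ j); rewrite nij /= negbK.
  by move/eqP.
(* Upper triangularity excludes i > j, hence j - i >= d - 1. *)
have ij : (i <= j)%N by apply: contraR Mij => /U0 ->.
by have := frweight_entry ij Mij; lia.
Qed.

(** * Dimension counts against spaces of small weight *)

Lemma dim_packing (F : fieldType) (n d : nat) (V A B : {vspace 'M[F]_n}) :
    (A <= V)%VS -> (B <= V)%VS ->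
    (forall M, M \in A -> M != 0 -> (d <= frweight M)%N) ->
    (forall M, M \in B -> (frweight M < d)%N) ->
  (\dim A + \dim B <= \dim V)%N.
Proof.
move=> AV BV wA wB; rewrite -dimv_disjoint_sum; first by apply: dimvS; rewrite subv_add AV.
apply/eqP; rewrite -subv0; apply/subvP => M /memv_capP[MA MB]; rewrite memv0.
by apply: contraT => /(wA M MA); rewrite leqNgt wB.
Qed.

Lemma codim_weight_ge (F : fieldType) (n d : nat) (A : {vspace 'M[F]_n}) :
    (1 <= d <= n)%N -> (A <= Dspace F (d - 1) n)%VS ->
    (forall M, M \in A -> M != 0 -> (d <= frweight M)%N) ->
  (\dim A + g d <= \dim (Dspace F (d - 1) n))%N.
Proof.
move=> hd AD wA; have [s [t [e [hts dE ->]]]] := g_shape d.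
have le_n : (s + t + e <= n)%N by nia.
(* The triangle fits because s + t <= s(t + 1) <= d - 1: t <= s rules out s = 0 < t. A diagonal
   position needs only d - 1 > 0, which e > 0 gives. *)
have BD : (supp_space F n (stair (s + t) e) <= Dspace F (d - 1) n)%VS.
  apply: supp_spaceS => i j /orP[]; last by nia.
  by case: s hts dE {le_n} => [|s]; nia.
have wB M : M \in supp_space F n (stair (s + t) e) -> (frweight M < d)%N.
  by move=> /(frweight_stair le_n hts); lia.
have := dim_packing AD BD wA wB; have := dim_stair F le_n.
by have [sE|sE] : s = t \/ s = (t + 1)%N; [lia | subst s; nia | subst s; nia].
Qed.

Lemma light_element (F : fieldType) (n d : nat) (A : {vspace 'M[F]_n}) :
    (1 <= d <= n)%N -> (A <= Uspace F n)%VS -> (\dim (Uspace F n) <= \dim A + g d)%N ->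
  exists M, [/\ M \in A, M != 0 & (frweight M <= d)%N].
Proof.
move=> hd AU dimA; have [s [t [e [hts dE gE]]]] := g_shape d.
(* The extra diagonal position raises the weight bound from d - 1 to d and still fits, as s + t + e
   + 1 <= d <= n. *)
have le_n : (s + t + e.+1 <= n)%N by clear - hd hts dE; nia.
pose B := supp_space F n (stair (s + t) e.+1).
have BU : (B <= Uspace F n)%VS by apply: supp_spaceS => i j; rewrite /stair; lia.
have dimB : \dim B = (g d).+1.
  rewrite gE; have := dim_stair F le_n; rewrite -/B; move: (\dim B) => b.
  by clear - hts dE hd; have [sE|sE] : s = t \/ s = (t + 1)%N; [lia | subst s; lia | subst s; lia].
exists (vpick (A :&: B)); have /memv_capP[-> MB] := memv_pick (A :&: B).
split=> //; last by have := frweight_stair le_n hts MB; lia.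
rewrite vpick0; apply/eqP => AB0.
have : (\dim (A + B) <= \dim (Uspace F n))%N by apply: dimvS; rewrite subv_add AU.
by rewrite dimv_disjoint_sum // dimB; lia.
Qed.

(** * Recognising MFRD codes and comparing the conditions *)

Lemma is_min_frdist_uniq (F : fieldType) (n d d' : nat) (C : {vspace 'M[F]_n}) :
  is_min_frdist C d -> is_min_frdist C d' -> d = d'.
Proof.
move=> [[M [MC M0 <-]] minM] [[M' [MC' M0' <-]] minM'].
by apply/eqP; rewrite eqn_leq minM // minM'.
Qed.

Lemma Uspace_dimE (F : fieldType) (n : nat) : \dim (Uspace F n) = ((n * (n + 1)) %/ 2)%N.
Proof. by rewrite -(dim_Uspace F n) mulKn. Qed.

(** Dimension [f n d] already forces a nonzero element of weight at most [d], so the lower bound is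
    attained. *)
Lemma MFRD_weight_ge (F : fieldType) (n d : nat) (C : {vspace 'M[F]_n}) :
    (1 <= d <= n)%N -> (C <= Uspace F n)%VS -> \dim C = f n d ->
    (forall M, M \in C -> M != 0 -> (d <= frweight M)%N) ->
  is_MFRD d C.
Proof.
move=> hd CU dimC wC; split=> //; split=> //.
have dimU : (\dim (Uspace F n) <= \dim C + g d)%N.
  by rewrite dimC /f Uspace_dimE; lia.
have [M [MC M0 wM]] := light_element hd CU dimU.
by exists M; split=> //; apply/eqP; rewrite eqn_leq wM wC.
Qed.

Theorem theorem4p14 (F : fieldType) (n d r : nat)
    (hn : (2 <= n)%N) (hd : (1 <= d <= n)%N)
    (C : {vspace 'M[F]_n})
    (hCU : (C <= Uspace F n)%VS)
    (hCdim : \dim C = f n d)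
    (hCr : is_min_frdist C r) :
  let CD := (C :&: Dspace F (d - 1) n)%VS in
  let wt_ge := forall M, M \in CD -> M != 0 -> (d <= frweight M)%N in
  let codim_g := (\dim (Dspace F (d - 1) n) - \dim CD)%N = g d in
  let dim_y := \dim CD = (f n d - ((n - d + 1) * (n - d + 2)) %/ 2)%N in
  [/\ r = d <-> is_MFRD d C,
      r = d <-> wt_ge /\ codim_g,
      r = d <-> wt_ge /\ dim_y,
      codim_g <-> dim_y &
      r = d <-> directv (CD + phi1U F n d) /\
                is_MFRD d (CD + phi1U F n d)%VS].
Proof.
move=> CD wt_ge codim_g dim_y.
(* The upper right corner: a complement of D(d - 1) in U, containing the image of [phi1]. *)
pose K := supp_space F n (fun i j => i + (d - 1) <= j)%N.
have DU : (Dspace F (d - 1) n <= Uspace F n)%VS.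
  by apply: supp_spaceS => i j /andP[].
have dimK : \dim K = (((n - d + 1) * (n - d + 2)) %/ 2)%N.
  have := dim_supp_space_offset F n (d - 1); rewrite -/K.
  by rewrite (_ : n - (d - 1) = n - d + 1)%N -?addnA => [<-|]; [rewrite mulKn | lia].
have dimU := dim_Uspace_Dspace F n (d - 1); rewrite -/K in dimU.
have CD_D : (CD <= Dspace F (d - 1) n)%VS by apply: capvSr.
have dimCD : (\dim CD <= \dim (Dspace F (d - 1) n))%N by apply: dimvS.
(* This makes the truncated subtractions in [f] and [dim_y] exact. *)
have gb := g_bound hd; rewrite -dimK -(Uspace_dimE F) in gb.
have codim_dim : codim_g <-> dim_y.
  by rewrite /codim_g /dim_y /f -dimK -(Uspace_dimE F); split; lia.
(* Packing gives codimension at least [g d]; the inclusion of C + D(d - 1) in U gives at most dim U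
   - dim C = [g d]. *)
have wt_codim : wt_ge -> codim_g.
  move=> /(codim_weight_ge hd CD_D) ub.
  have := dimv_sum_cap C (Dspace F (d - 1) n); rewrite -/CD hCdim /f -(Uspace_dimE F).
  have : (\dim (C + Dspace F (d - 1) n) <= \dim (Uspace F n))%N.
    by apply: dimvS; rewrite subv_add hCU.
  by rewrite /codim_g; lia.
have C_MFRD : wt_ge -> is_MFRD d C.
  move=> wCD; apply: MFRD_weight_ge => // M MC M0.
  have [MD|nMD] := boolP (M \in Dspace F (d - 1) n); first by apply: wCD; rewrite ?memv_cap ?MC.
  exact: frweight_outside_Dspace (subvP hCU M MC) nMD.
have MFRD_r : is_MFRD d C -> r = d by case=> _ _; apply: is_min_frdist_uniq.
(* The equivalences with r = d all pass through [wt_ge]. *)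
have r_wt : r = d <-> wt_ge.
  split=> [rd M /memv_capP[MC _] M0 | /C_MFRD/MFRD_r //].
  by rewrite -rd; apply: hCr.2.
have CD_phi0 : (CD :&: phi1U F n d)%VS = 0%VS.
  by apply/eqP; rewrite -subv0 -(Dspace_phi1U_disjoint F n d) capvS.
have sumU : (CD + phi1U F n d <= Uspace F n)%VS.
  rewrite subv_add (subv_trans CD_D) //=; apply: subv_trans (phi1U_sub _ _ _) _.
  by apply: supp_spaceS => i j; lia.
have dim_phi : \dim (phi1U F n d) = \dim K.
  by rewrite dim_phi1U // Uspace_dimE dimK -addnA.
have sum_MFRD : wt_ge -> is_MFRD d (CD + phi1U F n d)%VS.
  move=> wCD; apply: MFRD_weight_ge => //.
    rewrite dimv_disjoint_sum // dim_phi (codim_dim.1 (wt_codim wCD)).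
    by rewrite -dimK /f -(Uspace_dimE F); lia.
  move=> M MS M0; have MU := subvP sumU M MS.
  have [MD|nMD] := boolP (M \in Dspace F (d - 1) n); last exact: frweight_outside_Dspace nMD.
  (* Since [M] and [A] lie in D(d - 1), so does [B]; but the image of [phi1] meets D(d - 1) only in
     0. *)
  apply: wCD => //; case/memv_addP: MS => A AC [B BK defM].
  suff -> : M = A by [].
  have BD : B \in Dspace F (d - 1) n.
    by rewrite -[B](addKr A) -defM rpredD // rpredN (subvP CD_D).
  have /eqP B0 : B == 0.
    by rewrite -memv0 -(Dspace_phi1U_disjoint F n d) memv_cap BD.
  by rewrite defM B0 addr0.
split=> //.
- by split=> [/r_wt/C_MFRD | ].
- by split=> [/r_wt wCD | [/r_wt]]; first by split=> //; apply: wt_codim.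
- by split=> [/r_wt wCD | [/r_wt]]; first by split=> //; apply/codim_dim/wt_codim.
split=> [/r_wt wCD | [_ [_ _ [_ wS]]]].
  by split; [apply/directv_addP | apply: sum_MFRD].
(* [CD] inherits the weight bound from the sum that contains it. *)
apply/r_wt => M MCD; apply: wS; exact: subvP (addvSl _ _) M MCD.
Qed.
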